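(* The base-extension semantics for multi-agent $S5$ based on update sets is sound and complete with respect to multi-agent modal logic $S5$: for every formula $\phi$ of the language of multi-agent $S5$, $\phi$ is valid in the base-extension semantics based on update sets ($\Vdash\phi$) if and only if $\phi$ is a theorem of multi-agent $S5$ ($\vdash^{S5}\phi$).
   Context: Fix a countably infinite set $P$ of atoms and a set $A$ of agents. Formulas: $\phi::=p\mid\bot\mid\phi\to\phi\mid K_a\phi$ with $p\in P$, $a\in A$; $\neg\phi:=\phi\to\bot$. Bases. A base rule is a pair $(L,p)$, written $p_1,\dots,p_n\Rightarrow p$, with $L=\{p_1,\dots,p_n\}\subseteq P$ finite (possibly empty) and $p\in P$. A base is a countable set of base rules; $\Omega_P$ is the set of all bases. $\overline{B}$ is the closure of the empty set under the rules of $B$. $B$ is inconsistent if $\overline{B}=P$, otherwise consistent. $S5$-modal relations. A binary relation $R_a$ on $\Omega_P$ is an $S5$-modal relation if it is reflexive, transitive and Euclidean and for all $B$: (a) if $B$ is inconsistent, then there is an inconsistent $C$ with $R_aBC$, and every $D$ with $R_aBD$ is inconsistent; (b) if $B$ is consistent, every $C$ with $R_aBC$ is consistent; (c) for all $C$, if $R_aBC$, then for all consistent $D\supseteq B$ there is $E\supseteq C$ with $R_aDE$; (d) for all consistent $C$, if $R_aBC$, then for all $D\subseteq B$ there is $E\subseteq C$ with $R_aDE$. Reachability. Given $R_A=\{R_a\}_{a\in A}$, $C$ is reachable from $B$ (by $R_A$) if there is a finite chain of bases from $B$ to $C$ in which consecutive bases are related by some $R_a$, $a\in A$. $C$ is reachable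 from $B$ using the sub/superset relation if there is a finite chain of bases from $B$ to $C$ in which consecutive bases are related by $\subseteq$ or $\supseteq$. Update sets. $R_A=\{R_a\}_{a\in A}$ is an update set if: all $R_a$ are $S5$-modal relations; for all consistent $B,B'$ with $B'$ reachable from $B$ and $B'\subseteq B$, all $a\in A$ and all $C$, $R_aBC$ iff $R_aB'C$; and for every consistent $B$ there is a finite set $\pi(B)=\{\pi_1,\dots,\pi_n\}$ with each $\pi_i\subseteq\Omega_P$, such that for all $i$ and $C,D\in\pi_i$, $D$ is reachable from $C$ using the sub/superset relation, and for all $C$, $C$ is reachable from $B$ by $R_A$ iff $C\in\pi_i$ for some $i$. Support, for a base $B$ and an update set $R_A$: $\Vdash_{B,R_A}p$ iff $p\in\overline{B}$; $\Vdash_{B,R_A}\phi\to\psi$ iff $\phi\Vdash_{B,R_A}\psi$; $\Vdash_{B,R_A}\bot$ iff $\Vdash_{B,R_A}p$ for all $p\in P$; $\Vdash_{B,R_A}K_a\phi$ iff $\Vdash_{C,R_A}\phi$ for all $C$ with $R_aBC$; for nonempty $\Gamma$, $\Gamma\Vdash_{B,R_A}\phi$ iff for all $C\supseteq B$, if $\Vdash_{C,R_A}\psi$ for all $\psi\in\Gamma$ then $\Vdash_{C,R_A}\phi$. $\phi$ is valid, $\Vdash\phi$, iff $\Vdash_{B,R_A}\phi$ for all $B\in\Omega_P$ and all update sets $R_A$. Proof system $\vdash^{S5}$: axiom schemes $\phi\to(\psi\to\phi)$; $(\phi\to(\psi\to\chi))\to((\phi\to\psi)\to(\phi\to\chi))$;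 $(\neg\phi\to\neg\psi)\to(\psi\to\phi)$; $K_a(\phi\to\psi)\to(K_a\phi\to K_a\psi)$; $K_a\phi\to\phi$; $K_a\phi\to K_aK_a\phi$; $\neg K_a\phi\to K_a\neg K_a\phi$; rules modus ponens and necessitation (from $\psi$ infer $K_a\psi$). (Equivalently, $\phi$ is true at all worlds of all Kripke models whose relations are equivalence relations.) *)

(* Defs.v *)
From HB Require Import structures.
From mathcomp Require Import all_boot finmap.
From mathcomp Require Import boolp classical_sets functions cardinality.
From Stdlib Require Import Relation_Operators.

Set Implicit Arguments.
Unset Strict Implicit.
Unset Printing Implicit Defensive.

Local Open Scope classical_set_scope.

Inductive formula (P A : Type) : Type :=
| Atom of P
| Bot
| Imp of formula P A & formula P A
| K of A & formula P A.

Arguments Atom {P A} _.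
Arguments Bot {P A}.

Definition Neg (P A : Type) (phi : formula P A) : formula P A := Imp phi Bot.

(* (L, p) is the base rule "L => p". *)
Definition base_rule (P : choiceType) : Type := ({fset P} * P)%type.

Record base (P : choiceType) : Type := Base {
  rules :> set (base_rule P);
  rules_countable : countable rules }.

Definition subbase (P : choiceType) (B C : base P) : Prop :=
  rules B `<=` rules C.

Definition closed_under (P : choiceType) (B : base P) (X : set P) : Prop :=
  forall (L : {fset P}) (p : P), rules B (L, p) -> [set` L] `<=` X -> X p.

Definition base_closure (P : choiceType) (B : base P) : set P :=
  smallest (closed_under B) set0.

Definition inconsistent (P : choiceType) (B : base P) : Prop :=
  base_closure B = setT.

Definition consistent (P : choiceType) (B : base P) : Prop :=
  ~ inconsistent B.

Record S5_modal (P : choiceType) (R : base P -> base P -> Prop) : Prop := {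
  S5_refl : forall B, R B B;
  S5_trans : forall B C D, R B C -> R C D -> R B D;
  S5_eucl : forall B C D, R B C -> R B D -> R C D;
  S5_inconsistent : forall B, inconsistent B ->
    (exists C, inconsistent C /\ R B C) /\
    (forall D, R B D -> inconsistent D);
  S5_consistent : forall B, consistent B -> forall C, R B C -> consistent C;
  S5_up : forall B C, R B C ->
    forall D, consistent D -> subbase B D -> exists E, subbase C E /\ R D E;
  S5_down : forall B C, consistent C -> R B C ->
    forall D, subbase D B -> exists E, subbase E C /\ R D E }.

(* A chain may consist of a single base, so every base is reachable from
   itself. *)
Definition reachable (P : choiceType) (A : Type)
    (R : A -> base P -> base P -> Prop) : base P -> base P -> Prop :=
  clos_refl_trans (base P) (fun B C => exists a, R a B C).

Definition subsuper_reachable (P : choiceType) : base P -> base P -> Prop :=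
  clos_refl_trans (base P) (fun B C => subbase B C \/ subbase C B).

Record update_set (P : choiceType) (A : Type)
    (R : A -> base P -> base P -> Prop) : Prop := {
  update_S5 : forall a, S5_modal (R a);
  update_sub : forall B B', consistent B -> consistent B' ->
    reachable R B B' -> subbase B' B ->
    forall a C, R a B C <-> R a B' C;
  update_finite : forall B, consistent B ->
    exists pi : set (set (base P)),
      [/\ finite_set pi,
          forall X, pi X ->
            forall C D, X C -> X D -> subsuper_reachable C D &
          forall C, reachable R B C <-> exists X, pi X /\ X C] }.

(* [support R B phi] is support of phi at B without premises. The clause for
   [Imp phi psi] is "{phi} supports psi at B", written out for the singleton. *)
Fixpoint support (P : choiceType) (A : Type)
    (R : A -> base P -> base P -> Prop) (B : base P) (phi : formula P A) :
    Prop :=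
  match phi with
  | Atom p => base_closure B p
  | Bot => forall p : P, base_closure B p
  | Imp psi chi =>
      forall C, subbase B C -> support R C psi -> support R C chi
  | K a psi => forall C, R a B C -> support R C psi
  end.

Definition valid (P : choiceType) (A : Type) (phi : formula P A) : Prop :=
  forall (B : base P) (R : A -> base P -> base P -> Prop),
    update_set R -> support R B phi.

Inductive S5_theorem (P A : Type) : formula P A -> Prop :=
| ax_k phi psi : S5_theorem (Imp phi (Imp psi phi))
| ax_s phi psi chi :
    S5_theorem (Imp (Imp phi (Imp psi chi))
                    (Imp (Imp phi psi) (Imp phi chi)))
| ax_contra phi psi :
    S5_theorem (Imp (Imp (Neg phi) (Neg psi)) (Imp psi phi))
| ax_K a phi psi :
    S5_theorem (Imp (K a (Imp phi psi)) (Imp (K a phi) (K a psi)))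
| ax_T a phi : S5_theorem (Imp (K a phi) phi)
| ax_4 a phi : S5_theorem (Imp (K a phi) (K a (K a phi)))
| ax_5 a phi : S5_theorem (Imp (Neg (K a phi)) (K a (Neg (K a phi))))
| rule_MP phi psi :
    S5_theorem (Imp phi psi) -> S5_theorem phi -> S5_theorem psi
| rule_nec a psi : S5_theorem psi -> S5_theorem (K a psi).

(* Main.v *)
From mathcomp Require Import all_boot finmap.
From mathcomp Require Import fingroup perm.
From mathcomp Require Import boolp classical_sets functions cardinality.
From Stdlib Require Import Relation_Operators.
Require Import Defs.

(** Soundness is classical logic recovered from base extension. The key fact is
    that whatever a base fails to support is refuted by some consistent
    extension of it ([extension_refuting]): an atom is refuted by adding rules
    that make it explosive, and the conditions relating an S5-modal relation
    to inclusion carry the property through the modalities. Together with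
    monotonicity this validates contraposition; the modal axioms follow from
    each relation being an equivalence compatible with inclusion.

    For completeness, a formula that is not a theorem fails in a finite Kripke
    model with set of worlds [W] whose relations are equivalences
    ([finite_countermodel], a canonical model restricted to subformulas). Such a
    model is turned into an update set by letting symmetries act on bases.
    Replace worlds by permutations of [W], a permutation [g] standing for the
    world [g w0]: since an equivalence class is an orbit of the group of
    permutations that preserve all classes, the map from [g] to [g w0] is a
    bounded morphism when [g] and [g * h] are related for [a] exactly if [h]
    preserves the classes of [a]. A bijection [theta] between atoms and pairs
    (atom, set of worlds) lets every permutation of [W] act on the atoms, hence
    on the base rules, hence on the bases. These actions are automorphisms of
    the poset of bases that preserve consistency, so relating each base to its
    translates by the permutations that preserve the classes of [a] gives an
    S5-modal relation for free: the extension and restriction conditions merely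
    say that automorphisms preserve inclusion. Since [W] is finite, permutations
    have finite order, so a base is never a translate of a proper extension of
    itself, which is what an update set asks of comparable reachable bases.

    It remains to place the valuation. If [theta] sends each atom [p] of the
    formula to ([p], [V p]), and the root base decides every atom, deriving those
    whose set contains [w0], then the translate of the root base by [g] derives
    [p] exactly when [g w0] is in [V p]. Consistent extensions of that translate
    derive no further atoms, so implication is evaluated at a single world and
    support coincides with Kripke satisfaction ([world_base_support]). *)

Set Implicit Arguments.
Unset Strict Implicit.
Unset Printing Implicit Defensive.

Local Open Scope classical_set_scope.

(** * Countability and closures of bases *)

Lemma card_nat_bij (T : Type) : ([set: T] #= [set: nat])%card ->
  exists f : T -> nat, bijective f.
Proof. by move=> /card_set_bijP[f]; rewrite setTT_bijective; exists f. Qed.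

Lemma countable_rule_set (P : choiceType) (hP : ([set: P] #= [set: nat])%card)
  (S : set (base_rule P)) : countable S.
Proof.
have [f /bij_inj f_inj] := card_nat_bij hP.
apply/countable_injP.
exists (fun r : base_rule P => choice.pickle ([seq f x | x <- enum_fset r.1], f r.2)).
move=> [L p] [M q] _ _ /(pcan_inj choice.pickleK) /= [eqLM /f_inj ->].
by congr (_, _); apply/val_inj/(inj_map f_inj).
Qed.

Section Closure.
Variable P : choiceType.
Implicit Types (B C : base P) (p : P) (L : {fset P}).

Lemma base_closure_closed B : closed_under B (base_closure B).
Proof.
move=> L p BLp LB X [XB X0]; apply: (XB L p BLp) => q /LB; apply; by split.
Qed.

Lemma base_closure_min B (X : set P) :
  closed_under B X -> base_closure B `<=` X.
Proof. by move=> BX; apply: smallest_sub. Qed.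

Lemma base_closure_mono B C : subbase B C -> base_closure B `<=` base_closure C.
Proof.
move=> BC; apply: base_closure_min => L p /BC; exact: base_closure_closed.
Qed.

Lemma inconsistentP B : inconsistent B <-> forall p, base_closure B p.
Proof.
split=> [->//|Ball]; rewrite /inconsistent predeqE => p.
by split.
Qed.

Lemma inconsistent_mono B C : subbase B C -> inconsistent B -> inconsistent C.
Proof.
move=> BC /inconsistentP Ball; apply/inconsistentP => p.
exact: base_closure_mono BC _ (Ball p).
Qed.

Lemma subbase_refl B : subbase B B. Proof. by []. Qed.

Lemma subbase_trans B C (D : base P) :
  subbase B C -> subbase C D -> subbase B D.
Proof. exact: subset_trans. Qed.

End Closure.

(** * Soundness *)

Section Soundness.
Variables (P : choiceType) (A : Type).
Hypothesis hP : ([set: P] #= [set: nat])%card.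
Variable R : A -> base P -> base P -> Prop.
Hypothesis R_S5 : forall a, S5_modal (R a).
Implicit Types (B C D E : base P) (phi psi : formula P A).

Lemma support_inconsistent B phi : inconsistent B -> support R B phi.
Proof.
elim: phi B => [p||phi _ psi IHpsi|a phi IHphi] B Binc /=.
- by move/inconsistentP: Binc; apply.
- exact/inconsistentP.
- by move=> C BC _; apply/IHpsi/(inconsistent_mono BC).
- by move=> C /(proj2 (S5_inconsistent (R_S5 a) Binc)); apply: IHphi.
Qed.

(** The modal case is the restriction condition of S5-modal relations read
    upwards: a base related to the larger base contains one related to the
    smaller. *)
Lemma support_mono B C phi : subbase B C -> support R B phi -> support R C phi.
Proof.
elim: phi B C => [p||phi _ psi _|a phi IHphi] B C BC /=.
- exact: base_closure_mono.
- by move=> Ball p; apply: base_closure_mono BC _ _.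
- by move=> Bimp D CD; apply/Bimp/(subbase_trans BC).
- move=> BK D CD; have [Dinc|Dcon] := pselect (inconsistent D).
    exact: support_inconsistent.
  have [E [ED BE]] := S5_down (R_S5 a) Dcon CD BC.
  exact: IHphi ED (BK _ BE).
Qed.

Lemma S5_sym a B C : R a B C -> R a C B.
Proof. by move=> BC; apply: S5_eucl BC (S5_refl _ _). Qed.

(** Making [p] explosive keeps a base that does not derive [p] consistent,
    because rules with the single premise [p] never fire. *)
Lemma extension_refuting_atom B p : ~ base_closure B p ->
  exists C, [/\ subbase B C, consistent C & support R C (Neg (@Atom P A p))].
Proof.
move=> Bp.
pose S := rules B `|` [set r | r.1 = [fset p]%fset].
pose C := Base (countable_rule_set hP S).
have BC : subbase B C by move=> r; left.
exists C; split => //.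
- move=> /inconsistentP/(_ p) Cp; apply: (Bp).
  apply: (base_closure_min _ Cp) => L q [|/= -> /(_ p)].
    exact: base_closure_closed.
  by rewrite /= inE eqxx => /(_ isT)/Bp.
- move=> D CD Dp q; apply: (@base_closure_closed _ _ [fset p]%fset).
    by apply: CD; right.
  by move=> x /=; rewrite inE => /eqP ->.
Qed.

(** Semantic source of classical reasoning. For [K a phi], a refutation of [phi]
    at a related base is pulled back along the symmetric relation to an
    extension of [B], and the extension condition keeps it visible from all
    consistent extensions of that one. *)
Lemma extension_refuting B phi : ~ support R B phi ->
  exists C, [/\ subbase B C, consistent C & support R C (Neg phi)].
Proof.
elim: phi B => [p||phi _ psi IHpsi|a phi IHphi] B.
- exact: extension_refuting_atom.
- by move=> /= Bcon; exists B; split=> //; move/inconsistentP.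
- move=> /existsNP[C] /not_implyP[BC] /not_implyP[Cphi Cpsi].
  have [D [CD Dcon Dpsi]] := IHpsi _ Cpsi.
  exists D; split => //; first exact: subbase_trans CD.
  move=> E DE Eimp; apply: (Dpsi _ DE); apply: (Eimp E (@subbase_refl _ E)).
  exact: support_mono (subbase_trans CD DE) Cphi.
- move=> /existsNP[C] /not_implyP[BC] /IHphi[C' [CC' C'con C'phi]].
  have [D [BD C'D]] := S5_up (R_S5 a) (S5_sym BC) C'con CC'.
  have DC' := S5_sym C'D.
  exists D; split => //; first exact: (S5_consistent (R_S5 a) C'con C'D).
  move=> E DE EK; have [Einc|Econ] := pselect (inconsistent E).
    exact/inconsistentP.
  have [F [C'F EF]] := S5_up (R_S5 a) DC' Econ DE.
  have /inconsistentP := C'phi F C'F (EK F EF).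
  by move: (S5_consistent (R_S5 a) Econ EF).
Qed.

Lemma soundness phi : S5_theorem phi -> forall B, support R B phi.
Proof.
elim=> {phi} [phi psi|phi psi chi|phi psi|a phi psi|a phi|a phi|a phi
             |phi psi _ IHimp _ IHphi|a psi _ IHpsi] B.
- by move=> C _ Cphi D CD _; apply: support_mono CD Cphi.
- move=> C _ Cs D CD Dimp E DE Ephi.
  apply: (Cs E (subbase_trans CD DE) Ephi E (@subbase_refl _ E)).
  exact: Dimp.
- move=> C _ Ccontra D CD Dpsi; apply: contrapT.
  move=> /extension_refuting[E [DE Econ Ephi]].
  apply: Econ; apply/inconsistentP.
  apply: (Ccontra E (subbase_trans CD DE) Ephi E (@subbase_refl _ E)).
  exact: support_mono DE Dpsi.
- move=> C _ CK D CD DK E DE.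
  exact: (support_mono CD CK E DE E (@subbase_refl _ E) (DK E DE)).
- by move=> C _; apply; apply: S5_refl.
- by move=> C _ CK D CD E DE; apply: CK; apply: S5_trans CD DE.
- move=> C _ CnK D CD E DE EK; have [Einc|Econ] := pselect (inconsistent E).
    exact/inconsistentP.
  have [F [CF EF]] := S5_up (R_S5 a) (S5_sym CD) Econ DE.
  have /inconsistentP : support R F (@Bot P A).
    by apply: (CnK F CF) => G FG; apply: EK; apply: S5_trans EF FG.
  by move: (S5_consistent (R_S5 a) Econ EF).
- exact: (IHimp B B (@subbase_refl _ B) (IHphi B)).
- by move=> C _; apply: IHpsi.
Qed.

End Soundness.

(** * Derivations from sets of formulas *)

Section Derivations.
Variables (P A : Type).
Implicit Types (X Y : set (formula P A)) (phi psi chi : formula P A).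

Inductive derives X : formula P A -> Prop :=
| derives_hyp phi : X phi -> derives X phi
| derives_thm phi : S5_theorem phi -> derives X phi
| derives_mp phi psi : derives X (Imp phi psi) -> derives X phi -> derives X psi.

Lemma derives_sub X Y phi : X `<=` Y -> derives X phi -> derives Y phi.
Proof.
move=> XY; elim=> [psi /XY|psi|psi chi _ IH1 _]; first exact: derives_hyp.
  exact: derives_thm.
exact: derives_mp.
Qed.

Lemma derives_weak X phi psi : derives X psi -> derives X (Imp phi psi).
Proof. by apply: derives_mp; apply/derives_thm/ax_k. Qed.

Lemma deduction X phi psi :
  derives (X `|` [set phi]) psi -> derives X (Imp phi psi).
Proof.
elim=> [chi [/derives_hyp/derives_weak//|->]|chi thm|chi xi _ IH1 _ IH2].
- apply/derives_thm/(rule_MP (rule_MP (ax_s _ (Imp phi phi) _) _)); exact: ax_k.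
- exact/derives_weak/derives_thm.
- by apply: derives_mp IH2; apply: derives_mp IH1; apply/derives_thm/ax_s.
Qed.

Lemma derives_last X phi : derives (X `|` [set phi]) phi.
Proof. by apply: derives_hyp; right. Qed.

Lemma derives_prev X phi psi : derives X psi -> derives (X `|` [set phi]) psi.
Proof. by apply: derives_sub => ? ?; left. Qed.

Lemma derives_efq X phi : derives X Bot -> derives X phi.
Proof.
apply: derives_mp; apply: (derives_mp (derives_thm X (ax_contra phi Bot))).
exact/derives_weak/deduction/derives_last.
Qed.

(** Contraposition only concludes implications, so [phi] is obtained from a
    provable formula implying it. *)
Lemma derives_raa X phi : derives (X `|` [set Neg phi]) Bot -> derives X phi.
Proof.
move=> /deduction nnphi; pose top : formula P A := Imp Bot Bot.
have dtop Y : derives Y top by apply/deduction/derives_last.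
apply: derives_mp (dtop X).
apply: (derives_mp (derives_thm X (ax_contra phi top))).
apply/deduction/derives_weak.
exact: derives_mp (derives_prev _ nnphi) (derives_last _ _).
Qed.

(** Necessitation for derivations with premises, as used in the existence
    lemma of the canonical model. *)
Lemma derives_nec a X phi :
  derives [set psi | derives X (K a psi)] phi -> derives X (K a phi).
Proof.
elim=> [//|psi /(rule_nec a)|psi chi _ IH1 _ IH2]; first exact: derives_thm.
apply: derives_mp IH2; apply: derives_mp IH1; exact/derives_thm/ax_K.
Qed.

Definition deriv_consistent X := ~ derives X Bot.

Definition decides X phi := derives X phi \/ derives X (Neg phi).

Lemma decides_not_derives X phi : deriv_consistent X -> decides X phi ->
  ~ derives X phi <-> derives X (Neg phi).
Proof.
move=> Xcon [dphi|//]; last by move=> dn; split => // _ d; exact: Xcon (derives_mp dn d).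
by split=> // dn; case: Xcon; apply: derives_mp dn dphi.
Qed.

(** Deciding finitely many formulas suffices for a filtrated model, so the set is
    extended along a list, one formula at a time. *)
Lemma lindenbaum X (s : seq {classic formula P A}) : deriv_consistent X ->
  exists Y, [/\ X `<=` Y, deriv_consistent Y & {in s, forall phi, decides Y phi}].
Proof.
move=> Xcon; elim: s => [|phi s [Y [XY Ycon Ys]]]; first by exists X; split.
have [dphi|ndphi] := pselect (derives Y phi).
  exists Y; split=> // psi; rewrite inE => /predU1P[->|]; [by left|exact: Ys].
exists (Y `|` [set Neg phi]); split.
- by move=> psi /XY; left.
- by move=> /derives_raa.
- move=> psi; rewrite inE => /predU1P[->|/Ys[d|d]].
  + by right; apply: derives_last.
  + by left; apply: derives_prev.
  + by right; apply: derives_prev.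
Qed.

End Derivations.

(** * Finite Kripke countermodels *)

Section Kripke.
Variables (P A : Type).
Implicit Types (phi psi : formula P A).

Fixpoint satisfies (W : finType) (r : A -> rel W) (V : P -> {set W}) (w : W)
    (phi : formula P A) : Prop :=
  match phi with
  | Atom p => w \in V p
  | Bot => False
  | Imp psi chi => satisfies r V w psi -> satisfies r V w chi
  | K a psi => forall v, r a w v -> satisfies r V v psi
  end.

(** [formula P A] has no decidable equality for arbitrary [A]; membership in the
    list is taken in the classical choice structure. *)
Fixpoint subformulas phi : seq {classic formula P A} :=
  (phi : {classic formula P A}) ::
  match phi with
  | Imp psi chi => subformulas psi ++ subformulas chi
  | K _ psi => subformulas psi
  | _ => [::]
  end.

Section Canonical.
Variable S : seq {classic formula P A}.

Local Notation world := {set seq_sub S}.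

(** The members of [S] index the bits of a world; [label] reads an index as a
    formula. *)
Definition label (x : seq_sub S) : formula P A := ssval x.

Definition theory_world (X : set (formula P A)) : world :=
  [set x : seq_sub S | `[< derives X (label x) >]]%SET.

Definition realised_by (X : set (formula P A)) (w : world) : Prop :=
  [/\ deriv_consistent X, {in S, forall phi, decides X phi} & w = theory_world X].

(** Worlds are arbitrary subsets of [S], not only those coming from a consistent
    theory; requiring related worlds to agree on being realised keeps the
    spurious ones away from the realised ones while the relation remains an
    equivalence. *)
Definition canonical_rel (a : A) : rel world := fun w v =>
  `[< ((exists X, realised_by X w) <-> (exists X, realised_by X v)) /\
      forall x phi, label x = K a phi -> (x \in w) = (x \in v) >].

Definition canonical_val (p : P) : {set world} :=
  [set w : world | `[< exists2 x, x \in w & label x = Atom p >]]%SET.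

Lemma canonical_rel_equiv a : equivalence_rel (canonical_rel a).
Proof.
move=> u v w; split; first exact/asboolP.
move=> /asboolP[uv uvK]; apply/idP/idP => /asboolP[h hK]; apply/asboolP; split.
- by rewrite -uv.
- by move=> x phi xK; rewrite -(uvK _ _ xK) (hK _ _ xK).
- by rewrite uv.
- by move=> x phi xK; rewrite (uvK _ _ xK) (hK _ _ xK).
Qed.

Lemma canonical_truth phi X : {subset subformulas phi <= S} ->
  realised_by X (theory_world X) ->
  satisfies canonical_rel canonical_val (theory_world X) phi <-> derives X phi.
Proof.
elim: phi X => [p||phi IHphi psi IHpsi|a phi IHphi] X sub Xw;
  have [Xcon Xdec _] := Xw; have phiS := sub _ (mem_head _ _).
- rewrite /= inE; split=> [/asboolP[x]|dp].
    by rewrite inE => /asboolP + xp; rewrite xp.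
  apply/asboolP; exists (SeqSub phiS) => //.
  by rewrite inE; apply/asboolP.
- by split.
- have subphi : {subset subformulas phi <= S}.
    by move=> x xphi; apply: sub; rewrite inE mem_cat xphi orbT.
  have subpsi : {subset subformulas psi <= S}.
    by move=> x xpsi; apply: sub; rewrite inE mem_cat xpsi !orbT.
  rewrite /= IHphi // IHpsi //; split=> [imp|]; last exact: derives_mp.
  have [/imp|] := pselect (derives X phi); first exact: derives_weak.
  have hphi : (phi : {classic _}) \in S.
    by apply: subphi; case: (phi) => *; apply: mem_head.
  move=> /(decides_not_derives Xcon (Xdec _ hphi)) nphi.
  apply/deduction/derives_efq; apply: derives_mp (derives_last _ _).
  exact: derives_prev.
- have subphi : {subset subformulas phi <= S}.
    by move=> x xphi; apply: sub; rewrite inE xphi orbT.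
  split=> [sat|dK v].
    apply: contrapT => ndK.
    pose X0 := [set psi | derives X (K a psi)] `|` [set Neg phi].
    have X0con : deriv_consistent X0 by move=> /derives_raa dphi; apply/ndK/derives_nec.
    have [Y [X0Y Ycon Ydec]] := lindenbaum S X0con.
    have Yw : realised_by Y (theory_world Y) by [].
    have hyp psi : derives X (K a psi) -> derives Y psi.
      by move=> d; apply: derives_hyp; apply: X0Y; left.
    have /sat/(IHphi _ subphi Yw) dphi :
        canonical_rel a (theory_world X) (theory_world Y).
      apply/asboolP; split; first by split=> _; [exists Y|exists X].
      (* Axioms 4 and 5 transfer [K a psi] and its negation from [X] to [Y]. *)
      move=> [x xS] psi /= xK; rewrite !inE /= xK.
      apply/asboolP/asboolP => [dX|].
        by apply: hyp; apply: derives_mp dX; apply/derives_thm/ax_4.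
      apply: contraPP; rewrite xK in xS.
      rewrite (decides_not_derives Xcon (Xdec _ xS)).
      rewrite (decides_not_derives Ycon (Ydec _ xS)) => dX.
      by apply: hyp; apply: derives_mp dX; apply/derives_thm/ax_5.
    apply: Ycon; apply: derives_mp dphi.
    by apply: derives_hyp; apply: X0Y; right.
  move=> /asboolP[Xv XvK].
  have [Y [Ycon Ydec vE]] : exists X, realised_by X v by apply/Xv; exists X.
  rewrite vE; apply/(IHphi Y subphi) => //; apply: derives_mp; first exact/derives_thm/ax_T.
  have := XvK (SeqSub phiS) phi erefl; rewrite vE !inE /= asboolT //.
  by move=> /esym/asboolP.
Qed.

End Canonical.

(** The negation of a formula that is not a theorem is consistent; a theory
    containing it and deciding the subformulas gives the refuting world. *)
Theorem finite_countermodel phi : ~ S5_theorem phi ->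
  exists (W : finType) (r : A -> rel W) (V : P -> {set W}) (w : W),
    (forall a, equivalence_rel (r a)) /\ ~ satisfies r V w phi.
Proof.
move=> nthm.
have Xcon : deriv_consistent (set0 `|` [set Neg phi]).
  move=> /derives_raa; move: nthm; move: phi => phi nthm dphi; apply: nthm.
  by elim: dphi => [//|//|psi chi _ IH1 _]; apply: rule_MP.
have [Y [XY Ycon Ydec]] := lindenbaum (subformulas phi) Xcon.
have Yw : realised_by Y (theory_world (subformulas phi) Y) by [].
exists {set seq_sub (subformulas phi)}, (@canonical_rel (subformulas phi)),
  (@canonical_val (subformulas phi)), (theory_world (subformulas phi) Y).
split=> [a|/(canonical_truth (fun _ => id) Yw) dphi].
  exact: canonical_rel_equiv.
apply: Ycon; apply: derives_mp dphi.
by apply: derives_hyp; apply: XY; right.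
Qed.

End Kripke.

(** * Bases acted on by permutations of worlds *)

(** Values are prescribed one at a time, by composing with a transposition of
    the target; injectivity of [j] protects the values already fixed. *)
Lemma bijection_prescribed (T U : eqType) (f0 : T -> U) (j : T -> U) (s : seq T) :
  bijective f0 -> injective j ->
  exists2 f : T -> U, bijective f & {in s, f =1 j}.
Proof.
move=> f0_bij j_inj; elim: s => [|t s [f f_bij fs]]; first by exists f0.
pose swap x := if x == f t then j t else if x == j t then f t else x.
have swapK : involutive swap.
  move=> x; rewrite /swap; have [->|xf] := eqVneq x (f t).
    by have [->|] := eqVneq (j t) (f t); rewrite ?eqxx.
  by have [->|xj] := eqVneq x (j t); rewrite ?eqxx // (negPf xf) (negPf xj).
exists (swap \o f); first exact: bij_comp (inv_bij swapK) f_bij.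
move=> u; rewrite inE => /predU1P[->|us]; first by rewrite /= /swap eqxx.
rewrite /= /swap (inj_eq (bij_inj f_bij)).
have [->//|ut] := eqVneq u t.
by rewrite fs // (inj_eq j_inj) (negPf ut).
Qed.

Section Transport.
Variables (P : choiceType) (A : Type).
Hypothesis hP : ([set: P] #= [set: nat])%card.
Variables (W : finType) (r : A -> rel W).
Hypothesis r_equiv : forall a, equivalence_rel (r a).
Variables (theta : P -> P * {set W}) (theta' : P * {set W} -> P).
Hypotheses (thetaK : cancel theta theta') (theta'K : cancel theta' theta).

Implicit Types (g h : {perm W}) (B C D E : base P).

(** [theta] identifies the atoms with copies of the power set of [W], on which
    permutations act by direct image. *)
Definition atom_act g (p : P) : P := theta' ((theta p).1, g @: (theta p).2)%SET.

Lemma atom_act1 p : atom_act 1%g p = p.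
Proof.
rewrite /atom_act (eq_imset _ (@perm1 W)) imset_id -surjective_pairing.
exact: thetaK.
Qed.

Lemma atom_actM g h p : atom_act (g * h)%g p = atom_act h (atom_act g p).
Proof.
rewrite /atom_act theta'K /= -imset_comp; congr (theta' (_, _)).
by apply: eq_imset => x; rewrite permM.
Qed.

Definition rule_act g (rho : base_rule P) : base_rule P :=
  ([fset atom_act g x | x in rho.1]%fset, atom_act g rho.2).

Lemma rule_act1 rho : rule_act 1%g rho = rho.
Proof.
case: rho => L p; congr (_, _); last exact: atom_act1.
by apply/fsetP => x; rewrite (eq_imfset _ atom_act1 (fun _ => erefl)) imfset_id.
Qed.

Lemma rule_actM g h rho : rule_act (g * h)%g rho = rule_act h (rule_act g rho).
Proof.
congr (_, _); last exact: atom_actM.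
by rewrite -imfset_comp; apply: eq_imfset => // x; rewrite /= atom_actM.
Qed.

Lemma rule_actK g : cancel (rule_act g) (rule_act g^-1).
Proof. by move=> rho; rewrite -rule_actM mulgV rule_act1. Qed.

Lemma rule_actVK g : cancel (rule_act g^-1) (rule_act g).
Proof. by move=> rho; rewrite -rule_actM mulVg rule_act1. Qed.

(** Stated on rules, so that no equality between bases, which carry
    countability proofs, is ever needed. *)
Definition translate g B C : Prop :=
  forall rho, rules C (rule_act g rho) <-> rules B rho.

Lemma translate1 B : translate 1%g B B.
Proof. by move=> rho; rewrite rule_act1. Qed.

Lemma translateM g h B C D :
  translate g B C -> translate h C D -> translate (g * h)%g B D.
Proof. by move=> BC CD rho; rewrite rule_actM CD BC. Qed.

Lemma translateV g B C : translate g B C -> translate g^-1%g C B.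
Proof. by move=> BC rho; rewrite -BC rule_actVK. Qed.

Lemma translate_ex g B : exists C, translate g B C.
Proof.
exists (Base (countable_rule_set hP [set rho | rules B (rule_act g^-1%g rho)])).
by move=> rho; rewrite /= rule_actK.
Qed.

Lemma translate_sub g B C D E :
  translate g B C -> translate g D E -> subbase B D -> subbase C E.
Proof.
by move=> BC DE BD rho; rewrite -(rule_actVK g rho) BC DE; apply: BD.
Qed.

Lemma translate_closure g B C p : translate g B C ->
  base_closure C (atom_act g p) <-> base_closure B p.
Proof.
have half h D E q : translate h D E -> base_closure D q ->
    base_closure E (atom_act h q).
  move=> DE; move: q; apply: base_closure_min => L q /DE ELq Lsub.
  by apply: base_closure_closed ELq _ => x /= /imfsetP[y yL ->]; apply: Lsub.
move=> BC; split; last exact: half.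
by move/(half _ _ _ _ (translateV BC)); rewrite -atom_actM mulgV atom_act1.
Qed.

Lemma translate_inconsistent g B C : translate g B C ->
  inconsistent C <-> inconsistent B.
Proof.
have half h D E : translate h D E -> inconsistent D -> inconsistent E.
  move=> DE /inconsistentP Dall; apply/inconsistentP => p.
  rewrite -(atom_act1 p) -(mulVg h) atom_actM.
  exact/(translate_closure _ DE).
by move=> BC; split; [exact: half (translateV BC)|exact: half BC].
Qed.

(** Iterating [g] never leaves [B], and some positive power of [g] is the
    identity. *)
Lemma translate_sub_eq g B C : translate g B C -> subbase C B -> rules C = rules B.
Proof.
move=> BC CB; apply/seteqP; split=> // rho Brho.
have iter n : rules B (rule_act (g ^+ n)%g rho).
  elim: n => [|n IHn]; first by rewrite expg0 rule_act1.
  by rewrite expgSr rule_actM; apply/CB/BC.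
rewrite -(rule_act1 rho) -(expg_order g) -(prednK (order_gt0 g)).
by rewrite expgSr rule_actM; apply/BC.
Qed.

Definition orbit_rel (a : A) B C : Prop :=
  exists2 g : {perm W}, (forall w, r a w (g w)) & translate g B C.

Let r_refl a w : r a w w. Proof. by have [] := r_equiv a w w w. Qed.

Let r_trans a u v w : r a u v -> r a v w -> r a u w.
Proof. by have [_ rE] := r_equiv a u v w; move=> /rE ->. Qed.

Let r_sym a u v : r a u v -> r a v u.
Proof. by have [_ rE] := r_equiv a u v u; move=> /rE <-. Qed.

Lemma orbit_rel_trans a B C D : orbit_rel a B C -> orbit_rel a C D -> orbit_rel a B D.
Proof.
move=> [g rg BC] [h rh CD]; exists (g * h)%g; last exact: translateM CD.
by move=> w; rewrite permM; apply: r_trans (rh _).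
Qed.

Lemma orbit_rel_sym a B C : orbit_rel a B C -> orbit_rel a C B.
Proof.
move=> [g rg BC]; exists g^-1%g; last exact: translateV.
by move=> w; apply: r_sym; rewrite -{2}(permKV g w).
Qed.

Lemma orbit_rel_S5 a : S5_modal (orbit_rel a).
Proof.
have refl B : orbit_rel a B B.
  by exists 1%g; [move=> w; rewrite perm1|exact: translate1].
split => //.
- exact: orbit_rel_trans.
- by move=> B C D /orbit_rel_sym; apply: orbit_rel_trans.
- move=> B Binc; split; first by exists B.
  by move=> D [g _ /translate_inconsistent] ->.
- by move=> B Bcon C [g _ /translate_inconsistent]; rewrite /consistent => ->.
- move=> B C [g rg BC] D _ BD; have [E DE] := translate_ex g D.
  by exists E; split; [exact: translate_sub BD|exists g].
- move=> B C _ [g rg BC] D DB; have [E DE] := translate_ex g D.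
  by exists E; split; [exact: translate_sub DB|exists g].
Qed.

Lemma orbit_rel_reachable B C : reachable orbit_rel B C -> exists g, translate g B C.
Proof.
elim=> [D E [a [g _ DE]]|D|D E F _ [g DE] _ [h EF]]; first by exists g.
  by exists 1%g; apply: translate1.
by exists (g * h)%g; apply: translateM EF.
Qed.

Lemma orbit_rel_update_set : update_set orbit_rel.
Proof.
split; first exact: orbit_rel_S5.
  move=> B B' _ _ /orbit_rel_reachable[g BB'] B'B a C.
  by rewrite /orbit_rel /translate (translate_sub_eq BB' B'B).
move=> B _; exists [set [set C | reachable orbit_rel B C]]; split.
- exact: finite_set1.
  (* The empty base lies below any two bases, so all reachable bases form a
     single class. *)
- move=> _ _ C D _ _; pose O := Base (countable_rule_set hP set0).
  by apply: (rt_trans _ _ _ O); apply: rt_step; [right|left].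
- by move=> C; split=> [BC|[_ [->]]//]; exists [set C | reachable orbit_rel B C].
Qed.

Variables (V : P -> {set W}) (w0 : W).

Definition root_atoms : set P := [set p | w0 \in (theta p).2].

(** The root base decides every atom: it proves those of [root_atoms] and makes
    all others explosive, so that its consistent extensions have the same
    closure. *)
Definition root_base : base P := Base (countable_rule_set hP
  [set rho | (rho.1 = fset0 /\ root_atoms rho.2) \/
             exists2 p, ~ root_atoms p & rho.1 = [fset p]%fset]).

(** The consistent extensions of the translate of [root_base] by [g]; they all
    represent the world [g w0]. *)
Definition world_base g D : Prop :=
  consistent D /\ forall rho, rules root_base rho -> rules D (rule_act g rho).

(** The root base is consistent because an atom whose set of worlds is empty is
    not in [root_atoms]. *)
Lemma root_base_world : world_base 1%g root_base.
Proof.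
split=> [inc|rho]; last by rewrite rule_act1.
have [p] : exists p : P, True.
  by have [f [f' _ _]] := card_nat_bij hP; exists (f' 0%N).
suff: root_atoms (theta' (p, finset.set0)) by rewrite /root_atoms /= theta'K inE.
move/inconsistentP: inc => /(_ (theta' (p, finset.set0))).
apply: base_closure_min => L q [/= [_ //]|/= [x nx ->] /(_ x)].
by rewrite /= inE eqxx => /(_ isT).
Qed.

Lemma world_base_closure g D p : world_base g D ->
  base_closure D (atom_act g p) <-> root_atoms p.
Proof.
move=> [Dcon DB]; split=> [Dp|pQ]; last first.
  apply: (@base_closure_closed _ D (atom_act g @` fset0)%fset).
    by apply: (DB (fset0, p)); left.
  by move=> x /=; rewrite imfset0 inE.
apply: contrapT => npQ; apply: Dcon; apply/inconsistentP => q.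
rewrite -(atom_act1 q) -(mulVg g) atom_actM.
apply: (@base_closure_closed _ D (atom_act g @` [fset p])%fset).
  by apply: (DB ([fset p]%fset, _)); right; exists p.
by move=> x /=; rewrite imfset_fset1 inE => /eqP ->.
Qed.

Fixpoint atoms (phi : formula P A) : seq P :=
  match phi with
  | Atom p => [:: p]
  | Bot => [::]
  | Imp psi chi => atoms psi ++ atoms chi
  | K _ psi => atoms psi
  end.

(** Consistent extensions of a base representing a world represent the same
    world, and inconsistent ones support everything, so implication is
    material. For [K a phi], a related world [v] is reached by the transposition
    of [g w0] and [v], which preserves the classes of [a]. *)
Lemma world_base_support phi g D :
  {in atoms phi, forall p, theta p = (p, V p)} -> world_base g D ->
  support orbit_rel D phi <-> satisfies r V (g w0) phi.
Proof.
elim: phi g D => [p||phi IHphi psi IHpsi|a phi IHphi] g D phiV Dg.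
- have thetap := phiV p (mem_head _ _).
  have {1}-> : p = atom_act g (atom_act g^-1%g p).
    by rewrite -atom_actM mulVg atom_act1.
  rewrite /= world_base_closure // /root_atoms /= /atom_act theta'K thetap /=.
  rewrite -{1}(permK g w0) mem_imset //; exact: perm_inj.
- split=> // Dall; case: Dg => Dcon _; exact/Dcon/inconsistentP.
- have {}IHphi E : world_base g E -> support orbit_rel E phi <-> satisfies r V (g w0) phi.
    by apply: IHphi => p pphi; apply: phiV; rewrite mem_cat pphi.
  have {}IHpsi E : world_base g E -> support orbit_rel E psi <-> satisfies r V (g w0) psi.
    by apply: IHpsi => p ppsi; apply: phiV; rewrite mem_cat ppsi orbT.
  split=> /= [imp /(IHphi D Dg) Dphi|imp E DE].
    exact/(IHpsi D Dg)/(imp D (@subbase_refl _ D)).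
  have [Einc|Econ] := pselect (inconsistent E).
    by move=> _; apply: support_inconsistent Einc; apply: orbit_rel_S5.
  have Eg : world_base g E by split=> // rho /(proj2 Dg)/DE.
  by move=> /(IHphi E Eg)/imp/(IHpsi E Eg).
- have step h E : translate h D E -> world_base (g * h)%g E.
    move=> DE; split; first by move/(translate_inconsistent DE); case: Dg.
    by move=> rho /(proj2 Dg); rewrite rule_actM DE.
  split=> /= [sup v gv|sat E [h rh DE]]; last first.
    by apply/(IHphi _ _ phiV (step _ _ DE)); rewrite permM; apply: sat.
  have [E DE] := translate_ex (tperm (g w0) v) D.
  have := IHphi _ _ phiV (step _ _ DE); rewrite permM tpermL => <-.
  apply: sup; exists (tperm (g w0) v) => // w.
  by case: tpermP => [->|->|] //; apply: r_sym.
Qed.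

End Transport.

Lemma valid_satisfies (P : choiceType) (A : Type)
    (hP : ([set: P] #= [set: nat])%card) (phi : formula P A) (W : finType)
    (r : A -> rel W) (V : P -> {set W}) (w : W) :
  (forall a, equivalence_rel (r a)) -> valid phi -> satisfies r V w phi.
Proof.
move=> r_equiv phi_valid.
have [f0 f0_bij] : exists f0 : P -> P * {set W}, bijective f0.
  have [f f_bij] := card_nat_bij hP.
  have /card_nat_bij[g [g' gK g'K]] : ([set: P * {set W}] #= [set: nat])%card.
    have := @cardXR_eq_nat _ _ _ (fun _ : P => [set: {set W}]) hP.
    rewrite (_ : _ `*`` _ = setT); last by apply/seteqP; split.
    apply=> _; split; first exact: countableP.
    by exists finset.set0.
  by exists (g' \o f); apply: bij_comp => //; exists g.
have graph_inj : injective (fun p => (p, V p)) by move=> p q [].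
have [theta [theta' thetaK theta'K] thetaV] :=
  bijection_prescribed (atoms phi) f0_bij graph_inj.
have := world_base_support r_equiv thetaK theta'K thetaV
  (root_base_world hP thetaK theta'K w).
rewrite perm1 => <-; apply: phi_valid.
exact: (orbit_rel_update_set hP r_equiv thetaK theta'K).
Qed.

(** * Soundness and completeness *)

Theorem theorem2 (P : choiceType) (A : Type)
    (hP : ([set: P] #= [set: nat])%card) (phi : formula P A) :
  valid phi <-> S5_theorem phi.
Proof.
split=> [phi_valid|thm B R [R_S5 _ _]]; last exact: soundness.
apply: contrapT => /finite_countermodel[W [r [V [w [r_equiv]]]]]; apply.
exact: valid_satisfies.
Qed.
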